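(* (Working in $\mathbf{ZF}$.) A generalized topological space $X$ is topologically compact if and only if it is topologically $\mathbf{GTS}$-complete, i.e. for every generalized topological space $Y$ and every set $C$ weakly closed in the $\mathbf{GTS}$-product $X\times_{\mathbf{GTS}}Y$, the projection $\pi_Y(C)$ is weakly closed in $Y$.
   Context: A generalized topological space (gts) $(X,\mathrm{Op}_X,\mathrm{Cov}_X)$ is in the sense of Delfs–Knebusch: $\mathrm{Op}_X\subseteq\mathcal P(X)$ (open sets), $\mathrm{Cov}_X\subseteq\mathcal P(\mathrm{Op}_X)$ (admissible coverings) satisfying (A1) $\emptyset,X\in\mathrm{Op}_X$; (A2) finite unions and intersections of open sets are open; (A3) finite families of open sets are admissible; (A4) unions of admissible families are open; (A5) for admissible $\mathcal U$ and open $V\subseteq\bigcup\mathcal U$, $\{V\cap U:U\in\mathcal U\}$ is admissible; (A6) if $\mathcal U$ is admissible and each $U\in\mathcal U$ has an admissible covering $\mathcal V_U$ with union $U$, then $\bigcup_U\mathcal V_U$ is admissible; (A7) a family $\mathcal V$ of open sets with the same union as an admissible $\mathcal U$, such that every member of $\mathcal U$ lies in a member of $\mathcal V$, is admissible; (A8) if $\mathcal U$ is admissible, $V\subseteq\bigcup\mathcal U$ and all $V\cap U$ ($U\in\mathcal U$) are open, then $V$ is open. A generalized topology in a set $Z$ is a collection $\mathrm{Cov}$ with $(Z,\bigcup\mathrm{Cov},\mathrm{Cov})$ a gts; for $\mathcal A$ a collection of families of subsets of $Z$, $\langle\mathcal A\rangle_Z$ is the smallest generalized topology in $Z$ containing $\mathcal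 A$. Weakly open (closed) sets of a gts are the open (closed) sets of the topology generated by its open sets; the gts is topologically compact if this topology is compact. The $\mathbf{GTS}$-product $X\times_{\mathbf{GTS}}Y$ is the set $X\times Y$ with the generalized topology $\langle\{\pi_X^{-1}(\mathcal U):\mathcal U\in\mathrm{Cov}_X\}\cup\{\pi_Y^{-1}(\mathcal V):\mathcal V\in\mathrm{Cov}_Y\}\rangle_{X\times Y}$, where $\pi_X,\pi_Y$ are the projections and $\pi^{-1}(\mathcal U)=\{\pi^{-1}(U):U\in\mathcal U\}$. *)

(* Defs.v *)
From Stdlib Require Import List.

Section Sets.
Variable T : Type.

Definition set_union (U V : T -> Prop) : T -> Prop := fun x => U x \/ V x.
Definition set_inter (U V : T -> Prop) : T -> Prop := fun x => U x /\ V x.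
Definition set_compl (U : T -> Prop) : T -> Prop := fun x => ~ U x.
Definition subset (U V : T -> Prop) : Prop := forall x, U x -> V x.
Definition bigU (F : (T -> Prop) -> Prop) : T -> Prop :=
  fun x => exists U, F U /\ U x.
Definition finite_family (F : (T -> Prop) -> Prop) : Prop :=
  exists l : list (T -> Prop), forall U, F U <-> In U l.

(* Delfs–Knebusch axioms (A1)–(A8) for (T, Op, Cov), together with
   Cov ⊆ P(Op). *)
Definition is_gts (Op : (T -> Prop) -> Prop)
    (Cov : ((T -> Prop) -> Prop) -> Prop) : Prop :=
  (forall F, Cov F -> forall U, F U -> Op U) /\
  Op (fun _ => False) /\ Op (fun _ => True) /\
  (forall U V, Op U -> Op V -> Op (set_union U V) /\ Op (set_inter U V)) /\
  (forall F, (forall U, F U -> Op U) -> finite_family F -> Cov F) /\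
  (forall F, Cov F -> Op (bigU F)) /\
  (forall F V, Cov F -> Op V -> subset V (bigU F) ->
     Cov (fun W => exists U, F U /\ W = set_inter V U)) /\
  (forall (F : (T -> Prop) -> Prop) (G : (T -> Prop) -> (T -> Prop) -> Prop),
     Cov F -> (forall U, F U -> Cov (G U) /\ bigU (G U) = U) ->
     Cov (fun W => exists U, F U /\ G U W)) /\
  (forall F G, Cov F -> (forall V, G V -> Op V) -> bigU G = bigU F ->
     (forall U, F U -> exists V, G V /\ subset U V) -> Cov G) /\
  (forall F V, Cov F -> subset V (bigU F) ->
     (forall U, F U -> Op (set_inter V U)) -> Op V).

Definition opens_of (Cov : ((T -> Prop) -> Prop) -> Prop) :
    (T -> Prop) -> Prop :=
  fun U => exists F, Cov F /\ F U.

Definition is_gen_topology (Cov : ((T -> Prop) -> Prop) -> Prop) : Prop :=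
  is_gts (opens_of Cov) Cov.

Definition gen_topology_generated (A : ((T -> Prop) -> Prop) -> Prop) :
    ((T -> Prop) -> Prop) -> Prop :=
  fun F => forall Cov, is_gen_topology Cov ->
    (forall G, A G -> Cov G) -> Cov F.

Definition is_topology (Tau : (T -> Prop) -> Prop) : Prop :=
  Tau (fun _ => False) /\ Tau (fun _ => True) /\
  (forall U V, Tau U -> Tau V -> Tau (set_inter U V)) /\
  (forall F, (forall U, F U -> Tau U) -> Tau (bigU F)).

Definition generated_topology (B : (T -> Prop) -> Prop) :
    (T -> Prop) -> Prop :=
  fun W => forall Tau, is_topology Tau -> (forall U, B U -> Tau U) -> Tau W.

Definition compact_topology_gen (B : (T -> Prop) -> Prop) : Prop :=
  forall F, (forall U, F U -> generated_topology B U) ->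
    (forall x, bigU F x) ->
    exists l : list (T -> Prop), (forall U, In U l -> F U) /\
      (forall x, exists U, In U l /\ U x).

End Sets.

Arguments bigU {T}.
Arguments subset {T}.
Arguments set_compl {T}.

Record gts (X : Type) := Gts {
  Op : (X -> Prop) -> Prop;
  Cov : ((X -> Prop) -> Prop) -> Prop;
  gts_axioms : is_gts X Op Cov }.
Arguments Op {X}.
Arguments Cov {X}.

Definition weakly_open {X : Type} (G : gts X) (W : X -> Prop) : Prop :=
  generated_topology X (Op G) W.
Definition weakly_closed {X : Type} (G : gts X) (C : X -> Prop) : Prop :=
  weakly_open G (set_compl C).
Definition top_compact {X : Type} (G : gts X) : Prop :=
  compact_topology_gen X (Op G).

Definition preim_family {A B : Type} (f : A -> B)
    (F : (B -> Prop) -> Prop) : (A -> Prop) -> Prop :=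
  fun W => exists U, F U /\ W = (fun a => U (f a)).

Definition prod_Cov {X Y : Type} (G : gts X) (H : gts Y) :
    (((X * Y) -> Prop) -> Prop) -> Prop :=
  gen_topology_generated (X * Y)
    (fun F => (exists U, Cov G U /\ F = preim_family fst U) \/
              (exists V, Cov H V /\ F = preim_family snd V)).

Definition prod_Op {X Y : Type} (G : gts X) (H : gts Y) :
    ((X * Y) -> Prop) -> Prop :=
  opens_of (X * Y) (prod_Cov G H).

Definition prod_weakly_closed {X Y : Type} (G : gts X) (H : gts Y)
    (C : (X * Y) -> Prop) : Prop :=
  generated_topology (X * Y) (prod_Op G H) (set_compl C).

(* Main.v *)
(* If X is compact, every weakly open set of the GTS-product is open for the
   ordinary product topology (the open rectangles already form an admissible
   structure containing the generating coverings), so the classical tube lemma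
   shows that projections along X of weakly closed sets are weakly closed.
   Conversely, given a weakly open cover F of X without finite subcover, adjoin
   a point ∞ to X whose neighbourhoods are the sets containing the complement
   of a finite union of members of F.  The projection of the closure of the
   graph {(x, x)} of X → X ∪ {∞} then contains ∞ (no finite subcover) but
   cannot contain it (a member of F containing x separates (x, ∞) from the
   graph), a contradiction. *)
Require Import Defs.
From Stdlib Require Import List Classical FunctionalExtensionality PropExtensionality.

Lemma pred_ext {T : Type} (A B : T -> Prop) : (forall x, A x <-> B x) -> A = B.
Proof.
  intro h; apply functional_extensionality; intro x.
  apply propositional_extensionality; apply h.
Qed.

Section GeneratedTopology.
Context {T : Type}.

Lemma generated_topology_base (B : (T -> Prop) -> Prop) U :
  B U -> generated_topology T B U.
Proof. intros hU Tau _ hB; apply hB; exact hU. Qed.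

Lemma generated_topology_least (B Tau : (T -> Prop) -> Prop) :
  is_topology T Tau -> (forall U, B U -> Tau U) ->
  forall U, generated_topology T B U -> Tau U.
Proof. intros hT hB U hU; apply hU; assumption. Qed.

Lemma generated_topology_is_topology (B : (T -> Prop) -> Prop) :
  is_topology T (generated_topology T B).
Proof.
  repeat split.
  - intros Tau hT _; apply hT.
  - intros Tau hT _; apply hT.
  - intros U V hU hV Tau hT hB. apply hT; [apply hU | apply hV]; assumption.
  - intros F hF Tau hT hB. apply hT. intros U hU. apply hF; assumption.
Qed.

Lemma topology_open_of_local (Tau : (T -> Prop) -> Prop) (W : T -> Prop) :
  is_topology T Tau ->
  (forall x, W x -> exists U, Tau U /\ U x /\ subset U W) -> Tau W.
Proof.
  intros [_ [_ [_ hunion]]] hloc.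
  replace W with (bigU (fun U => Tau U /\ subset U W)).
  - apply hunion. intros U [hU _]; exact hU.
  - apply pred_ext; intro x; split.
    + intros [U [[_ hUW] hx]]; apply hUW, hx.
    + intro hx. destruct (hloc x hx) as [U [hU [hUx hUW]]].
      exists U; auto.
Qed.

Definition gen_closure (B : (T -> Prop) -> Prop) (D : T -> Prop) : T -> Prop :=
  fun p => forall W, generated_topology T B W -> W p -> exists q, D q /\ W q.

Lemma gen_closure_closed (B : (T -> Prop) -> Prop) (D : T -> Prop) :
  generated_topology T B (set_compl (gen_closure B D)).
Proof.
  apply topology_open_of_local; [apply generated_topology_is_topology |].
  intros p hp. apply NNPP. intro hnloc. apply hp. intros W hW hWp.
  apply NNPP. intro hdisj. apply hnloc. exists W. split; [exact hW |]. split; [exact hWp |].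
  intros q hWq hclos. destruct (hclos W hW hWq) as [r [hDr hWr]].
  apply hdisj. exists r; auto.
Qed.

Definition open_coverings (tau : (T -> Prop) -> Prop) :
    ((T -> Prop) -> Prop) -> Prop :=
  fun F => forall U, F U -> tau U.

Lemma open_coverings_gts (tau : (T -> Prop) -> Prop) :
  is_topology T tau -> is_gts T tau (open_coverings tau).
Proof.
  intros [t0 [t1 [tinter tunion]]].
  unfold is_gts, open_coverings.
  split; [auto |]. split; [auto |]. split; [auto |].
  split.
  { intros U V hU hV. split; [| auto].
    replace (set_union T U V) with (bigU (fun W => W = U \/ W = V)).
    - apply tunion. intros W [-> | ->]; auto.
    - apply pred_ext; intro x; unfold set_union, bigU; split.
      + intros [W [[-> | ->] h]]; auto.
      + intros [h | h]; [exists U | exists V]; auto. }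
  split; [auto |].
  split; [intros F hF; apply tunion; auto |].
  split; [intros F V hF hV _ W [U [hU ->]]; apply tinter; auto |].
  split; [intros F G hF hG W [U [hU hW]]; apply (proj1 (hG U hU)); auto |].
  split; [auto |].
  intros F V hF hsub hI.
  apply topology_open_of_local; [repeat split; auto |].
  intros x hx. destruct (hsub x hx) as [U [hU hUx]].
  exists (set_inter T V U). repeat split; auto.
  intros y [hy _]; exact hy.
Qed.

Lemma open_coverings_gen_topology (tau : (T -> Prop) -> Prop) :
  is_topology T tau -> is_gen_topology T (open_coverings tau).
Proof.
  intro htau. unfold is_gen_topology.
  replace (opens_of T (open_coverings tau)) with tau by
    (apply pred_ext; intro U; split;
     [intro hU; exists (fun V => V = U); split; [intros V ->; auto | reflexivity]
     | intros [F [hF hU]]; apply hF; auto]).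
  apply open_coverings_gts; exact htau.
Qed.

End GeneratedTopology.

Section GtsFacts.
Context {X : Type} (G : gts X).

Lemma gts_cov_open F U : Cov G F -> F U -> Op G U.
Proof. destruct (gts_axioms X G) as [h _]; intros; eapply h; eauto. Qed.

Lemma gts_open_full : Op G (fun _ => True).
Proof. destruct (gts_axioms X G) as [_ [_ [h _]]]; exact h. Qed.

Lemma gts_open_inter U V : Op G U -> Op G V -> Op G (set_inter X U V).
Proof. destruct (gts_axioms X G) as [_ [_ [_ [h _]]]]; intros; apply h; auto. Qed.

Lemma gts_cov_singleton U : Op G U -> Cov G (fun V => V = U).
Proof.
  intro hU. destruct (gts_axioms X G) as [_ [_ [_ [_ [hfin _]]]]].
  apply hfin; [intros V ->; exact hU |].
  exists (U :: nil). intro V; simpl; split; [auto | intros [-> | []]; reflexivity].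
Qed.

Lemma gts_open_nbhd_list_inter (A : Type) (Q : A -> (X -> Prop) -> Prop) (y : X) :
  (forall a V V', Q a V -> subset V' V -> Q a V') ->
  forall l : list A, (forall a, In a l -> exists V, Op G V /\ V y /\ Q a V) ->
  exists V, Op G V /\ V y /\ forall a, In a l -> Q a V.
Proof.
  intros hmono l. induction l as [| a l IH]; intro hl.
  - exists (fun _ => True). split; [exact gts_open_full | split; [exact I | intros a []]].
  - destruct IH as [V1 [hV1 [hyV1 hQ1]]]; [intros b hb; apply hl; right; exact hb |].
    destruct (hl a (or_introl eq_refl)) as [V2 [hV2 [hyV2 hQ2]]].
    exists (set_inter X V1 V2). split; [apply gts_open_inter; auto |].
    split; [split; auto |].
    intros b [<- | hb]; eapply hmono; eauto; intros z [hz1 hz2]; auto.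
Qed.

End GtsFacts.

Section ProductOpens.
Context {X Y : Type} (G : gts X) (H : gts Y).

Lemma prod_Op_preim_fst U : Op G U -> prod_Op G H (fun p => U (fst p)).
Proof.
  intro hU. exists (preim_family fst (fun V => V = U)). split.
  - intros Cv _ hgen. apply hgen. left. exists (fun V => V = U).
    split; [apply gts_cov_singleton; exact hU | reflexivity].
  - exists U; auto.
Qed.

Lemma prod_Op_preim_snd V : Op H V -> prod_Op G H (fun p => V (snd p)).
Proof.
  intro hV. exists (preim_family snd (fun W => W = V)). split.
  - intros Cv _ hgen. apply hgen. right. exists (fun W => W = V).
    split; [apply gts_cov_singleton; exact hV | reflexivity].
  - exists V; auto.
Qed.

Lemma prod_weakly_open_preim_fst U :
  weakly_open G U ->
  generated_topology (X * Y) (prod_Op G H) (fun p => U (fst p)).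
Proof.
  pose proof (generated_topology_is_topology (prod_Op G H))
    as [t0 [t1 [tinter tunion]]].
  apply (generated_topology_least (Op G)
           (fun A => generated_topology (X * Y) (prod_Op G H) (fun p => A (fst p)))).
  - split; [exact t0 |]. split; [exact t1 |]. split.
    + intros A B hA hB. exact (tinter _ _ hA hB).
    + intros F hF.
      replace (fun p : X * Y => bigU F (fst p))
        with (bigU (fun W => exists A, F A /\ W = (fun p : X * Y => A (fst p)))).
      * apply tunion. intros W [A [hA ->]]. apply hF; exact hA.
      * apply pred_ext; intro p; split.
        -- intros [W [[A [hA ->]] hp]]. exists A; auto.
        -- intros [A [hA hAp]]. exists (fun q : X * Y => A (fst q)); split; [exists A |]; auto.
  - intros A hA. apply generated_topology_base, prod_Op_preim_fst; exact hA.
Qed.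

Definition rect_open (W : X * Y -> Prop) : Prop :=
  forall p, W p -> exists U V, Op G U /\ Op H V /\ U (fst p) /\ V (snd p) /\
    (forall q, U (fst q) -> V (snd q) -> W q).

Lemma rect_open_topology : is_topology (X * Y) rect_open.
Proof.
  split; [intros p [] |]. split.
  { intros p _. exists (fun _ => True), (fun _ => True).
    repeat split; auto using gts_open_full. }
  split.
  { intros W1 W2 hW1 hW2 p [hp1 hp2].
    destruct (hW1 p hp1) as [U1 [V1 [hU1 [hV1 [hx1 [hy1 hsub1]]]]]].
    destruct (hW2 p hp2) as [U2 [V2 [hU2 [hV2 [hx2 [hy2 hsub2]]]]]].
    exists (set_inter X U1 U2), (set_inter Y V1 V2).
    split; [apply gts_open_inter; auto |].
    split; [apply gts_open_inter; auto |].
    split; [split; auto |]. split; [split; auto |].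
    intros q [hq1 hq2] [hq1' hq2']. split; auto. }
  intros F hF p [W [hW hp]].
  destruct (hF W hW p hp) as [U [V [hU [hV [hx [hy hsub]]]]]].
  exists U, V. repeat split; auto. intros q hq1 hq2. exists W; auto.
Qed.

(* The open-covering structure of the product topology is a generalized
   topology containing the generating coverings, hence contains ⟨…⟩. *)
Lemma prod_Op_rect_open W : prod_Op G H W -> rect_open W.
Proof.
  intros [F [hF hW]].
  apply (hF (open_coverings rect_open)); [| | exact hW].
  - apply open_coverings_gen_topology, rect_open_topology.
  - intros F0 [[U [hU ->]] | [V [hV ->]]] W0 [A [hA ->]] p hp.
    + exists A, (fun _ => True).
      repeat split; auto using gts_open_full. eapply gts_cov_open; eauto.
    + exists (fun _ => True), A.
      repeat split; auto using gts_open_full. eapply gts_cov_open; eauto.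
Qed.

Lemma prod_weakly_open_rect_open W :
  generated_topology (X * Y) (prod_Op G H) W -> rect_open W.
Proof.
  apply generated_topology_least;
    [apply rect_open_topology | exact prod_Op_rect_open].
Qed.

Lemma tube_lemma (W : X * Y -> Prop) (y : Y) :
  top_compact G -> rect_open W -> (forall x, W (x, y)) ->
  exists V, Op H V /\ V y /\ forall x y', V y' -> W (x, y').
Proof.
  intros hcomp hW hy.
  set (Q := fun (U : X -> Prop) (V : Y -> Prop) =>
              forall x y', U x -> V y' -> W (x, y')).
  destruct (hcomp (fun U => Op G U /\ exists V, Op H V /\ V y /\ Q U V))
    as [l [hl hlcov]].
  - intros U [hU _]; apply generated_topology_base; exact hU.
  - intro x. destruct (hW (x, y) (hy x)) as [U [V [hU [hV [hx [hyV hsub]]]]]].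
    exists U. split; [| exact hx]. split; [exact hU |].
    exists V. repeat split; auto. intros x' y' hx' hy'. apply (hsub (x', y')); auto.
  - destruct (gts_open_nbhd_list_inter H (X -> Prop) Q y) with (l := l) as [V [hV [hyV hQ]]].
    + intros U V V' hUV hV'V x y' hx hy'. apply hUV; auto.
    + intros U hU. apply (hl U hU).
    + exists V. repeat split; auto. intros x y' hy'.
      destruct (hlcov x) as [U [hU hUx]]. apply (hQ U hU); auto.
Qed.

End ProductOpens.

Lemma projection_weakly_closed_of_compact (X Y : Type) (G : gts X) (H : gts Y)
    (C : X * Y -> Prop) :
  top_compact G -> prod_weakly_closed G H C ->
  weakly_closed H (fun y => exists x, C (x, y)).
Proof.
  intros hcomp hC. unfold weakly_closed, weakly_open.
  apply topology_open_of_local; [apply generated_topology_is_topology |].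
  intros y hy.
  destruct (tube_lemma G H (set_compl C) y hcomp)
    as [V [hV [hyV htube]]].
  - apply prod_weakly_open_rect_open; exact hC.
  - intros x hx. apply hy. exists x; exact hx.
  - exists V. split; [apply generated_topology_base; exact hV |].
    split; [exact hyV |]. intros y' hy' [x hx]. apply (htube x y' hy' hx).
Qed.

Section OnePointExtension.
Variables (X : Type) (F : (X -> Prop) -> Prop).

(* X ∪ {∞} with ∞ = None: a neighbourhood of ∞ contains every point outside
   some finite union of members of F. *)
Definition one_point_open (W : option X -> Prop) : Prop :=
  W None -> exists l, (forall U, In U l -> F U) /\
    forall x, (forall U, In U l -> ~ U x) -> W (Some x).

Lemma one_point_open_topology : is_topology (option X) one_point_open.
Proof.
  split; [intros [] |]. split.
  { intros _. exists nil. split; [intros U [] | auto]. }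
  split.
  { intros A B hA hB [hA0 hB0].
    destruct (hA hA0) as [l1 [hl1 c1]]. destruct (hB hB0) as [l2 [hl2 c2]].
    exists (l1 ++ l2). split.
    - intros U hU. apply in_app_or in hU. destruct hU; auto.
    - intros x hx. split; [apply c1 | apply c2];
        intros U hU; apply hx; apply in_or_app; auto. }
  intros Fm hFm [W [hW hW0]].
  destruct (hFm W hW hW0) as [l [hl c]]. exists l. split; [exact hl |].
  intros x hx. exists W; auto.
Qed.

Definition one_point_gts : gts (option X) :=
  Gts (option X) one_point_open (open_coverings one_point_open)
    (open_coverings_gts one_point_open one_point_open_topology).

End OnePointExtension.

Lemma compact_of_projection_weakly_closed (X : Type) (G : gts X) :
  (forall (Y : Type) (H : gts Y) (C : (X * Y) -> Prop),
     prod_weakly_closed G H C ->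
     weakly_closed H (fun y => exists x, C (x, y))) ->
  top_compact G.
Proof.
  intros hproj F hF hcov.
  set (HY := one_point_gts X F).
  set (C := gen_closure (prod_Op G HY) (fun p : X * option X => snd p = Some (fst p))).
  assert (hdiag : forall x, C (x, Some x)).
  { intros x W _ hW. exists (x, Some x); auto. }
  assert (hnotinf : ~ exists x, C (x, None)).
  { intros [x hx]. destruct (hcov x) as [U [hU hUx]].
    set (V := fun y : option X => match y with None => True | Some x' => ~ U x' end).
    assert (hV : one_point_open X F V).
    { intros _. exists (U :: nil). split.
      - intros U' [<- | []]; exact hU.
      - intros x' hx'. apply (hx' U); simpl; auto. }
    destruct (hx (set_inter _ (fun p => U (fst p)) (fun p => V (snd p))))
      as [[x' y'] [hdq [hUx' hVy']]].
    - apply generated_topology_is_topology.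
      + apply prod_weakly_open_preim_fst, hF; exact hU.
      + apply generated_topology_base, (prod_Op_preim_snd G HY V hV).
    - split; simpl; auto.
    - simpl in *; subst y'. exact (hVy' hUx'). }
  assert (hprojopen : one_point_open X F (set_compl (fun y => exists x, C (x, y)))).
  { apply (generated_topology_least (Op HY)); [apply one_point_open_topology | auto |].
    apply hproj, gen_closure_closed. }
  destruct (hprojopen hnotinf) as [l [hl hfin]].
  exists l. split; [exact hl |].
  intro x. apply NNPP. intro hnx.
  apply (hfin x); [| exists x; apply hdiag].
  intros U hU hUx. apply hnx. exists U; auto.
Qed.

Theorem theorem4p15 (X : Type) (G : gts X) :
  top_compact G <->
  (forall (Y : Type) (H : gts Y) (C : (X * Y) -> Prop),
     prod_weakly_closed G H C ->
     weakly_closed H (fun y => exists x, C (x, y))).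
Proof.
  split.
  - intros hcomp Y H C. apply projection_weakly_closed_of_compact; exact hcomp.
  - apply compact_of_projection_weakly_closed.
Qed.
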